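(* Let $(\Omega,\mathcal{A},\mathbb{P})$ be a probability space, let $(E,\mathcal{B})$ be a Borel space, and let $X=(X_n)_{n\in\mathbb{N}}$ be a sequence of random variables on $(\Omega,\mathcal{A},\mathbb{P})$ with values in $(E,\mathcal{B})$. If $X$ is exchangeable, then there exists a random variable $M$ with values in $\mathcal{M}_1(E)$ such that, conditionally on $M=\mu$, the $X_n$'s are i.i.d. with common distribution $\mu$; that is, for all $k\in\mathbb{N}$ and all $A_1,\ldots,A_k\in\mathcal{B}$, $$\mathbb{P}(X_1\in A_1,\ldots,X_k\in A_k)=\int \prod_{i=1}^k \mu(A_i)\ \mathbb{P}^M(d\mu).$$
   Context: $\mathbb{N}=\{1,2,\ldots\}$. A measurable space $(E,\mathcal{B})$ is Borel if there is a measure-theoretic isomorphism (a bijection measurable in both directions) between it and a Borel subset of the real line. $\mathcal{M}_1(E)$ is the set of probability measures on $(E,\mathcal{B})$, endowed with the $\sigma$-field $\mathcal{B}(\mathcal{M}_1(E))$ generated by the maps $\mu\mapsto\mu(A)$, $A\in\mathcal{B}$. $\mathbb{P}^M$ denotes the distribution (push-forward of $\mathbb{P}$ under $M$) of the random variable $M:\Omega\to\mathcal{M}_1(E)$. Let $E_\infty$ be the set of all sequences $x=(x_n)_{n\in\mathbb{N}}$ of elements of $E$, with $\sigma$-field $\mathcal{B}_\infty$ generated by the coordinate projections $x\mapsto x_i$, $i\in\mathbb{N}$. The sequence $X$ is regarded as a random variable with values in $(E_\infty,\mathcal{B}_\infty)$, with distribution $\mathbb{P}^X$. Let $\mathbb{S}$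 be the set of finite permutations of $\mathbb{N}$, i.e. bijections $\pi:\mathbb{N}\to\mathbb{N}$ with $\#\{i:\pi(i)\neq i\}<\infty$. Each $\pi\in\mathbb{S}$ defines $\phi_\pi:E_\infty\to E_\infty$, $(x_n)_{n\in\mathbb{N}}\mapsto(x_{\pi(n)})_{n\in\mathbb{N}}$. $X$ is exchangeable if $\mathbb{P}^X$ is invariant under (push-forward by) $\phi_\pi$ for all $\pi\in\mathbb{S}$. *)

(* Defs.v *)
From HB Require Import structures.
From mathcomp Require Import all_boot all_order all_algebra.
From mathcomp Require Import all_classical all_reals all_analysis.
From mathcomp Require Import measurable_realfun.

Set Implicit Arguments.
Unset Strict Implicit.
Unset Printing Implicit Defensive.

Import Order.TTheory GRing.Theory Num.Theory.
Import numFieldNormedType.Exports.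

Local Open Scope classical_set_scope.
Local Open Scope ring_scope.

(* Since [B] is a Borel set, measurability of [f] and [g] as maps to and from
   [B] with its trace sigma-field is the same as measurability of [f] as a map
   to [R] together with [measurable_fun B g].  Every [measurableType] is
   nonempty, as is any space carrying a random variable. *)
Definition borel_space (R : realType) (d : measure_display)
    (E : measurableType d) : Prop :=
  exists (B : set R) (f : E -> R) (g : R -> E),
    [/\ measurable B, set_bij [set: E] B f, cancel f g,
        measurable_fun [set: E] f & measurable_fun B g].

(* Sequences are indexed from 0: [x i] is the coordinate written x_(i+1) when
   sequences are indexed by {1, 2, ...}. *)
Definition coord_preimages (d : measure_display) (E : measurableType d) :
    set (set (nat -> E)) :=
  \bigcup_(i in [set: nat])
    preimage_set_system [set: nat -> E] (fun x => x i) measurable.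
Arguments coord_preimages {d} E.

Definition seq_space (d : measure_display) (E : measurableType d) :
    measurableType (coord_preimages E).-sigma :=
  g_sigma_algebraType (coord_preimages E).
Arguments seq_space {d} E.

Section joint_random_variable.
Context (d d' : measure_display) (Omega : measurableType d)
  (E : measurableType d') (R : realType) (P : probability Omega R).
Variable X : nat -> {RV P >-> E}.

Definition joint (w : Omega) : seq_space E := fun n => X n w.

Lemma measurable_joint : measurable_fun [set: Omega] joint.
Proof.
apply: (measurability (coord_preimages E : set (set (seq_space E)))) => //.
move=> _ [_ [i _ [A mA <-]] <-]; rewrite !setTI.
rewrite -[X in measurable X]setTI.
exact: (measurable_funP (X i)).
Qed.

HB.instance Definition _ := isMeasurableFun.Build _ _ _ _ joint
  measurable_joint.

Definition joint_rv : {RV P >-> seq_space E} := joint.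

End joint_random_variable.

Definition finite_permutation (pi : nat -> nat) : Prop :=
  bijective pi /\ finite_set [set i | pi i <> i].

Definition permute_seq (d : measure_display) (E : measurableType d)
    (pi : nat -> nat) (x : seq_space E) : seq_space E :=
  fun n => x (pi n).

(* Two measures are compared on the sigma-field only: the value of a measure on
   a non-measurable set is irrelevant. *)
Definition exchangeable (d d' : measure_display) (Omega : measurableType d)
    (E : measurableType d') (R : realType) (P : probability Omega R)
    (X : nat -> {RV P >-> E}) : Prop :=
  forall pi : nat -> nat, finite_permutation pi ->
  forall A : set (seq_space E), measurable A ->
    pushforward (distribution P (joint_rv X)) (permute_seq pi) A =
    distribution P (joint_rv X) A.

(* The sigma-field of [pprobability E R], which the library generates by the
   sets {mu | mu U < r}, is the one generated by the evaluation maps. *)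
Lemma measurable_pprobabilityE (d : measure_display) (E : measurableType d)
    (R : realType) :
  (measurable : set (set (pprobability E R))) =
  <<s \bigcup_(U in measurable) preimage_set_system
        [set: pprobability E R]
        (fun mu : pprobability E R => (mu : probability E R) U)
        (measurable : set (set (\bar R))) >>.
Proof.
apply/seteqP; split.
- apply: smallest_sub; first exact: smallest_sigma_algebra.
  move=> _ [r _ [U mU <-]]; apply: sub_sigma_algebra.
  exists U => //; exists `]-oo, r%:E[%classic; first exact: emeasurable_itv.
  by rewrite setTI /mset; apply/seteqP; split => mu /=; rewrite in_itv.
- apply: smallest_sub; first exact: sigma_algebra_measurable.
  move=> _ [U mU [B mB <-]].
  suff : measurable_fun [set: pprobability E R]
      (fun mu : pprobability E R => (mu : probability E R) U) by exact.
  exact: (measurable_kernel (kprobability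
    (@measurable_id _ (pprobability E R) setT))).
Qed.

(* Main.v *)
Require Import Defs.
From HB Require Import structures.
From mathcomp Require Import all_boot all_order all_algebra.
From mathcomp Require Import all_classical all_reals all_analysis.
From mathcomp Require Import measurable_realfun.
From mathcomp Require Import ring lra.

(** The directing measure [M] of an exchangeable sequence is the limit of its
    empirical measures.

    By exchangeability, the law of [(X (j 0), ..., X (j k.-1))] is the same for
    every injective [j] ([exchangeable_injective]): finite permutations move any
    [k] distinct indices to [0, ..., k.-1].  Two consequences follow for the
    frequency [freq X A n] with which the first [n] terms visit [A].

    First, the indicators of [X i \in A] have a common mean and a common
    correlation, so the mean square of [freq X A m - freq X A n] is at most
    [1 / n] for [n <= m].  Along the powers of 4 the increments are summable in
    mean, and the frequencies converge almost surely to a limit [limfreq X A]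
    ([ae_cvg_limfreq]).

    Secondly, expanding [\prod_(i < k) freq X (A i) n] gives an average of
    [P (forall i, A i (X (j i)))] over all [j : 'I_k -> 'I_n].  All but a
    proportion at most [k ^ 2 / n] of these [j] are injective, and the injective
    ones contribute the same value ([freq_moment]).  In the limit,
    [P (forall i, A i (X i)) = \int \prod_(i < k) limfreq X (A i)]
    ([exchangeable_limfreq]).

    It remains to replace the set function [limfreq X], which is countably
    additive only up to a null set depending on the sets ([ae_limfreq_bigcup]),
    by a genuine random probability measure; this is where [E] has to be Borel.
    Embed [E] into the open interval ]0, 1[ by some [psi] with a measurable left
    inverse [phi].  For every outcome, the function
    [x |-> limfreq X (psi @^-1` `]-oo, x])] is nondecreasing, equal to 0 on the
    left of 0 and to 1 on the right of 1; its right-continuous envelope is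
    therefore a distribution function, without any exceptional null set.  The
    Lebesgue-Stieltjes measures so obtained agree almost surely with [limfreq X]
    on half-lines, hence on all Borel sets by Dynkin's lemma
    ([directing_measure_real]), and their images under [phi] form the random
    measure [M]. *)

Set Implicit Arguments.
Unset Strict Implicit.
Unset Printing Implicit Defensive.

Import Order.TTheory GRing.Theory Num.Theory.
Import numFieldNormedType.Exports.

Local Open Scope classical_set_scope.
Local Open Scope ring_scope.
Local Open Scope ereal_scope.

(** * Exchangeability along injective families of indices *)

Definition swap_nat (a b i : nat) : nat :=
  if i == a then b else if i == b then a else i.

Lemma swap_natK a b : involutive (swap_nat a b).
Proof.
move=> i; rewrite /swap_nat.
have [->|ia] := eqVneq i a; first by have [->//|//] := eqVneq b a; rewrite eqxx.
have [->|ib] := eqVneq i b; first by rewrite eqxx.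
by rewrite (negbTE ia) (negbTE ib).
Qed.

(** By induction on the list: a permutation that enumerates [s] is followed by
    the transposition exchanging the new entry [x] with the value at position
    [size s].  The transposition fixes the entries of [s], which differ from [x]
    because [x] is new, and from that value by injectivity. *)
Lemma uniq_prefix_of_permutation (s : seq nat) : uniq s ->
  exists pi, [/\ bijective pi, exists N, forall i, (N <= i)%N -> pi i = i
    & forall i, (i < size s)%N -> pi i = nth 0%N s i].
Proof.
elim/last_ind: s => [_|s x IH].
  by exists id; split => //; [exists id|exists 0%N].
rewrite rcons_uniq => /andP[xs /IH[pi [bpi [N piN] pis]]].
exists (swap_nat x (pi (size s)) \o pi); split.
- by apply: bij_comp => //; exact/inv_bij/swap_natK.
- exists (maxn N (maxn x.+1 (pi (size s)).+1)) => i.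
  rewrite !geq_max => /andP[Ni /andP[xi yi]] /=.
  by rewrite (piN i)// /swap_nat !gtn_eqF.
- move=> i; rewrite size_rcons ltnS leq_eqVlt nth_rcons /= /swap_nat.
  move=> /predU1P[->|si].
    by rewrite ltnn !eqxx; case: eqVneq.
  have pix : pi i != x.
    apply: contraNneq xs => <-; rewrite pis//; exact: mem_nth.
  have piy : pi i != pi (size s).
    by rewrite (inj_eq (bij_inj bpi)) (ltn_eqF si).
  by rewrite si -pis// (negbTE pix) (negbTE piy).
Qed.

Section exchangeable_events.
Context (R : realType) (d d' : measure_display) (Omega : measurableType d)
  (P : probability Omega R) (E : measurableType d').
Variables (X : nat -> {RV P >-> E}).

Lemma measurable_forall_coord (k : nat) (j : 'I_k -> nat) (A : 'I_k -> set E) :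
  (forall i, measurable (A i)) ->
  measurable [set x : seq_space E | forall i, A i (x (j i))].
Proof.
move=> mA.
rewrite [X in measurable X](_ : _ =
    \bigcap_(i in [set: 'I_k])
      [set x : seq_space E | A i (x (j i))]); last first.
  by apply/seteqP; split => [x h i _|x h i]; exact: h.
apply: fin_bigcap_measurable => // i _.
apply: sub_sigma_algebra; exists (j i) => //.
by exists (A i) => //; rewrite setTI.
Qed.

Lemma measurable_forall_rv (k : nat) (j : 'I_k -> nat) (A : 'I_k -> set E) :
  (forall i, measurable (A i)) ->
  measurable [set w | forall i, A i (X (j i) w)].
Proof.
move=> /(measurable_forall_coord j) mA.
have := @measurable_joint _ _ _ _ _ _ X measurableT _ mA.
by rewrite setTI.
Qed.

(** Apply exchangeability to a finite permutation that extends [j]. *)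
Lemma exchangeable_injective (k : nat) (j : 'I_k -> nat) (A : 'I_k -> set E) :
  exchangeable X -> injective j -> (forall i, measurable (A i)) ->
  P [set w | forall i, A i (X (j i) w)] =
  P [set w | forall i : 'I_k, A i (X i w)].
Proof.
move=> hX inj_j mA.
have /uniq_prefix_of_permutation[pi [bpi [N piN] pij]] :
  uniq [seq j i | i <- enum 'I_k] by rewrite map_inj_uniq// enum_uniq.
have pijE (i : 'I_k) : pi i = j i.
  have ik : (i < size (enum 'I_k))%N by rewrite size_enum_ord.
  rewrite pij; last by rewrite size_map.
  by rewrite (nth_map i 0%N j ik) nth_ord_enum.
have fpi : finite_permutation pi.
  split => //; apply: (sub_finite_set _ (finite_II N)) => l /= pil.
  by rewrite ltnNge; apply/negP => /piN.
have := hX pi fpi _ (measurable_forall_coord (fun i : 'I_k => val i) mA).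
rewrite /distribution /pushforward => hpi.
transitivity (P (joint_rv X @^-1`
    [set x : seq_space E | forall i : 'I_k, A i (x i)])); last by [].
rewrite -hpi; congr (P _).
by apply/seteqP; split => w h i; have := h i;
  rewrite /= /permute_seq /joint_rv /joint pijE.
Qed.

End exchangeable_events.

(** * Mean-square estimate for equicorrelated indicators *)

Section equicorrelated_events.
Context (R : realType) (d : measure_display) (Omega : measurableType d)
  (P : probability Omega R).

Variables (B : nat -> set Omega) (p q : R).
Hypotheses (mB : forall i, measurable (B i))
  (PB : forall i, P (B i) = p%:E)
  (PBB : forall i j, i != j -> P (B i `&` B j) = q%:E).

(** The covariance structure of the indicators is the constant [q] plus [p - q]
    times the identity matrix, whence the two terms.  The first one vanishes for
    the coefficients of a difference of two averages. *)
Lemma second_moment_indic_sum (m : nat) (a : nat -> R) :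
  \int[P]_w ((\sum_(i < m) a i * \1_(B i) w) ^+ 2)%:E =
  (q * (\sum_(i < m) a i) ^+ 2 + (p - q) * \sum_(i < m) (a i) ^+ 2)%:E.
Proof.
have E w : ((\sum_(i < m) a i * \1_(B i) w) ^+ 2)%:E =
    \sum_(i < m) \sum_(j < m) ((a i * a j)%:E * (\1_(B i `&` B j) w)%:E).
  rewrite expr2 big_distrlr/= -sumEFin; apply: eq_bigr => i _.
  rewrite -sumEFin; apply: eq_bigr => j _.
  by rewrite -EFinM indicI /= mulrACA.
have int1 (i j : nat) : P.-integrable [set: Omega]
    (fun w => (a i * a j)%:E * (\1_(B i `&` B j) w)%:E).
  apply: integrableZl => //; apply: integrable_indic => //.
  exact: measurableI.
under eq_integral do rewrite E.
rewrite integral_sum//; last by move=> i; exact: integrable_sum.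
under eq_bigr => i _.
  rewrite integral_sum//.
  under eq_bigr => j _.
    rewrite integralZl//; last first.
      by apply: integrable_indic => //; exact: measurableI.
    rewrite integral_indic//; last exact: measurableI.
    rewrite setIT.
    rewrite [X in _ * X](_ : _ = (q + (i == j)%:R * (p - q))%:E); last first.
      have [->|ij] := eqVneq i j.
        by rewrite setIid mul1r addrC subrK; exact: PB.
      by rewrite mul0r addr0; exact: PBB.
    rewrite -EFinM.
  over.
  rewrite sumEFin.
over.
rewrite sumEFin; congr (_%:E).
have row (i : 'I_m) :
    (\sum_(j < m) a i * a j * (q + (i == j :> nat)%:R * (p - q)) =
     a i * (q * \sum_(j < m) a j) + (p - q) * a i ^+ 2)%R.
  under eq_bigr => j _ do rewrite mulrDr.
  rewrite big_split/= !mulr_sumr; congr (_ + _)%R.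
    by apply: eq_bigr => j _; rewrite -mulrA (mulrC (a j)).
  rewrite (bigD1 i)//= eqxx mul1r big1 => [|j ji].
    by rewrite addr0 mulrC.
  have -> : (i == j :> nat) = false by apply: negbTE; rewrite eq_sym.
  by rewrite mul0r mulr0.
rewrite (eq_bigr _ (fun i _ => row i)) big_split/= -mulr_suml -mulr_sumr.
by congr (_ + _)%R; rewrite mulrC -mulrA -expr2.
Qed.

End equicorrelated_events.

(** * Almost sure convergence from geometric mean-square increments *)

Section ae_convergence.
Context (R : realType) (d : measure_display) (Omega : measurableType d)
  (P : probability Omega R).

Lemma cvgn_of_summable_increments (u : R^nat) :
  \sum_(0 <= k <oo) (`|u k.+1 - u k|)%:E < +oo -> cvgn u.
Proof.
move=> ufin.
have /normed_cvg : cvgn [normed series (fun k => u k.+1 - u k)%R].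
  exact: (@nnseries_is_cvg _ (fun k => `|u k.+1 - u k|%R)) ufin.
move=> cu; rewrite (_ : u = (fun n => u 0%N + series (telescope u) n)%R).
  by apply: is_cvgD; [exact: is_cvg_cst|exact: cu].
by apply/funext => n; exact: eq_sum_telescope.
Qed.

(** The increments have mean absolute value of order [2 ^- k], so their sum is
    integrable and therefore almost surely finite. *)
Lemma ae_cvgn_of_L2_increments (f : nat -> Omega -> R) :
  (forall k, measurable_fun [set: Omega] (f k)) ->
  (forall k, \int[P]_w ((f k.+1 w - f k w) ^+ 2)%:E <= ((4 ^+ k)^-1)%:E) ->
  {ae P, forall w, cvgn (f ^~ w)}.
Proof.
move=> mf f2.
have mdf k : measurable_fun [set: Omega] (fun w => f k.+1 w - f k w)%R.
  exact: measurable_funB.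
(* From the arithmetic-geometric mean inequality,
   [|x| <= 2 ^ k * x ^ 2 + 2 ^ - k]. *)
have int_le k : \int[P]_w (`|f k.+1 w - f k w|)%:E <= (2 * (2^-1) ^+ k)%:E.
  apply: (@le_trans _ _
    (\int[P]_w ((2 ^+ k)%:E * ((f k.+1 w - f k w) ^+ 2)%:E + (2 ^- k)%:E))).
    apply: ge0_le_integral => //.
    - by apply/measurable_EFinP; exact: measurableT_comp.
    - by apply: emeasurable_funD => //; apply/measurable_EFinP;
        apply: measurable_funM => //; exact: measurable_funX.
    - move=> w _; rewrite -EFinM -EFinD lee_fin.
      set x := (f k.+1 w - f k w)%R.
      have t0 : (0 < 2 ^+ k :> R)%R by rewrite exprn_gt0.
      have := sqr_ge0 (2 ^+ k * `|x| - 1)%R.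
      rewrite sqrrB expr1n mulr1 exprMn real_normK ?num_real// => sq.
      rewrite -(ler_pM2l t0) mulrDr mulfV ?gt_eqF// mulrA -expr2.
      have : (0 <= 2 ^+ k * `|x|)%R by rewrite mulr_ge0// ltW.
      lra.
  rewrite ge0_integralD//; last 2 first.
    - by move=> w _; rewrite lee_fin mulr_ge0 ?sqr_ge0.
    - by apply/measurable_EFinP; apply: measurable_funM => //;
        exact: measurable_funX.
  rewrite ge0_integralZl_EFin//; last 2 first.
    - by move=> w _; rewrite lee_fin sqr_ge0.
    - by apply/measurable_EFinP; exact: measurable_funX.
  rewrite integral_cst// [X in _ + _ * X](_ : _ = 1); last first.
    exact: probability_setT.
  rewrite mule1.
  apply: (@le_trans _ _ ((2 ^+ k)%:E * ((4 ^+ k)^-1)%:E + (2 ^- k)%:E)).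
    by rewrite leeD2r// lee_pmul2l// lte_fin exprn_gt0.
  rewrite -EFinM -EFinD lee_fin.
  have -> : (4 = 2 * 2 :> R)%R by rewrite -natrM.
  rewrite exprMn exprVn invfM mulrA mulfV ?mul1r; last by rewrite expf_neq0.
  by rewrite mulr_natl mulr2n.
have sum_lt : \int[P]_w \sum_(0 <= k <oo) (`|f k.+1 w - f k w|)%:E < +oo.
  rewrite integral_nneseries//; last first.
    by move=> k; apply/measurable_EFinP; exact: measurableT_comp.
  apply: (@le_lt_trans _ _ (\sum_(0 <= k <oo) (4 / (2 ^ (k + 1))%:R)%:E)).
    apply: lee_nneseries => [k _ _|k _]; first exact: integral_ge0.
    rewrite (le_trans (int_le k))// lee_fin addn1 expnS natrM natrX exprVn.
    by rewrite invfM mulrA -[4%R]/((2 * 2)%:R)%R natrM mulfK.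
  have /cvg_lim -> // := @cvg_geometric_eseries_half R 4 0.
  exact: ltry.
have mD : measurable_fun [set: Omega]
    (fun w => \sum_(0 <= k <oo) (`|f k.+1 w - f k w|)%:E).
  apply: ge0_emeasurable_sum => [//|k _].
  by apply/measurable_EFinP; exact: measurableT_comp.
have /integrable_ae : P.-integrable [set: Omega]
    (fun w => \sum_(0 <= k <oo) (`|f k.+1 w - f k w|)%:E).
  apply/integrableP; split => //.
  under eq_integral => w _.
    rewrite gee0_abs; last by apply: nneseries_ge0 => k _ _; rewrite lee_fin.
  over.
  exact: sum_lt.
move=> /(_ measurableT); apply: filterS => w /(_ I) wfin.
by apply: cvgn_of_summable_increments; rewrite ltey_eq wfin.
Qed.

End ae_convergence.

(** * Empirical frequencies *)

(** [n ^_ k / n ^ k] is the proportion of injective maps among all maps from a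
    set of size [k] to a set of size [n]; each new argument costs a factor
    [1 - k / n]. *)
Lemma ffact_ratio_ge (R : realType) (n k : nat) : (0 < n)%N ->
  (1 - (k ^ 2)%:R / n%:R <= (n ^_ k)%:R / (n ^ k)%:R :> R)%R.
Proof.
move=> n0; have nR : (0 < n%:R :> R)%R by rewrite ltr0n.
elim: k => [|k IH].
  by rewrite expn0 ffactn0 mul0r subr0 divr1.
rewrite ffactnSr (expnSr n) (natrM _ (n ^_ k)) (natrM _ (n ^ k)) invfM mulrACA.
move: IH; set r := ((n ^_ k)%:R / (n ^ k)%:R)%R => IH.
have r0 : (0 <= r)%R by rewrite /r divr_ge0.
have r1 : (r <= 1)%R.
  rewrite /r ler_pdivrMr ?mul1r ?ler_nat ?ltr0n ?expn_gt0 ?n0//.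
  elim: (k) => // l IHl.
  by rewrite ffactnSr (expnSr n) leq_mul// leq_subr.
have nk : (1 - k%:R / n%:R <= (n - k)%:R / n%:R :> R)%R.
  rewrite ler_pdivlMr// mulrBl mul1r divfK ?gt_eqF//.
  have [kn|nk] := leqP k n; first by rewrite natrB.
  by rewrite (le_trans _ (ler0n _ _))// subr_le0 ler_nat ltnW.
apply: (@le_trans _ _ (r * (1 - k%:R / n%:R))%R); last exact: ler_wpM2l.
have kn0 : (0 <= k%:R / n%:R :> R)%R by rewrite divr_ge0.
have : (r * (k%:R / n%:R) <= k%:R / n%:R)%R by rewrite ler_piMl.
have n1 : (0 <= n%:R^-1 :> R)%R by rewrite invr_ge0.
have : ((k.+1 ^ 2)%:R / n%:R =
    (k ^ 2)%:R / n%:R + 2 * (k%:R / n%:R) + n%:R^-1 :> R)%R.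
  by rewrite -addn1 sqrnD !natrD natrM; field; rewrite gt_eqF.
lra.
Qed.

Section empirical_frequency.
Context (R : realType) (d d' : measure_display) (Omega : measurableType d)
  (P : probability Omega R) (E : measurableType d').
Variable X : nat -> {RV P >-> E}.

Definition freq (A : set E) (n : nat) (w : Omega) : R :=
  (n%:R^-1 * \sum_(i < n) \1_A (X i w))%R.

Lemma freq_ge0 A n w : (0 <= freq A n w)%R.
Proof. by rewrite mulr_ge0 ?invr_ge0// sumr_ge0. Qed.

Lemma freqT n w : (0 < n)%N -> freq [set: E] n w = 1%R.
Proof.
move=> n0; rewrite /freq (eq_bigr (fun=> 1%R)) => [|i _].
  by rewrite sumr_const card_ord mulVf// pnatr_eq0 -lt0n.
by rewrite indicT.
Qed.

Lemma le_freq A B n w : A `<=` B -> (freq A n w <= freq B n w)%R.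
Proof.
move=> AB; rewrite ler_wpM2l ?invr_ge0//; apply: ler_sum => i _.
rewrite !indicE ler_nat; case: (boolP (X i w \in A)) => //.
by rewrite inE => /AB Bx; rewrite mem_set.
Qed.

Lemma freq_le1 A n w : (freq A n w <= 1)%R.
Proof.
have [->|n0] := posnP n; first by rewrite /freq big_ord0 mulr0.
by rewrite -(freqT w n0); exact: le_freq.
Qed.

Lemma freqC A n w : (0 < n)%N -> freq (~` A) n w = (1 - freq A n w)%R.
Proof.
move=> n0; rewrite -(freqT w n0) /freq -mulrBr -sumrB; congr (_ * _)%R.
apply: eq_bigr => i _; rewrite !indicE in_setC in_setT.
by case: (_ \in A); rewrite ?subrr ?subr0.
Qed.

Lemma sum_freq_le (F : (set E)^nat) N n w : trivIset [set: nat] F ->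
  (\sum_(j < N) freq (F j) n w <= freq (\bigcup_j F j) n w)%R.
Proof.
move=> tF; rewrite /freq -mulr_sumr exchange_big/=.
rewrite ler_wpM2l ?invr_ge0//; apply: ler_sum => i _.
rewrite -lee_fin indic_bigcup// -sumEFin -(big_mkord xpredT
  (fun j => (\1_(F j) (X i w))%:E)).
by apply: nneseries_lim_ge => j _; rewrite lee_fin.
Qed.

Lemma measurable_freq A n : measurable A ->
  measurable_fun [set: Omega] (freq A n).
Proof.
move=> mA; apply: measurable_funM => //.
apply: measurable_sum => i.
by apply: measurableT_comp => //; exact: measurable_indic.
Qed.

Section exchangeable.
Hypothesis hX : exchangeable X.

(** The difference of two averages is a combination of indicators whose
    coefficients sum to 0 and have square sum [1 / n - 1 / m]. *)
Lemma freq_L2_increment (A : set E) (n m : nat) : measurable A ->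
  (0 < n <= m)%N ->
  \int[P]_w ((freq A m w - freq A n w) ^+ 2)%:E <= (n%:R^-1)%:E.
Proof.
move=> mA /andP[n0 nm]; have m0 := leq_trans n0 nm.
pose B i := X i @^-1` A.
have mB i : measurable (B i) by rewrite -[B i]setTI; exact: measurable_funP.
pose p := fine (P (B 0%N)); pose q := fine (P (B 0%N `&` B 1%N)).
have PB i : P (B i) = p%:E.
  rewrite /p fineK ?fin_num_measure//.
  have := @exchangeable_injective _ _ _ _ _ _ _ 1 (fun=> i) (fun=> A) hX.
  have <- : [set w | forall _ : 'I_1, A (X i w)] = B i.
    by apply/seteqP; split => w h; [exact: (h ord0)|move=> _; exact: h].
  move=> ->//; last by move=> x y _; rewrite !ord1.
  congr (P _); apply/seteqP; split => w; first by move/(_ ord0).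
  by move=> h j; rewrite ord1.
have PBB i j : i != j -> P (B i `&` B j) = q%:E.
  move=> ij; rewrite /q fineK ?fin_num_measure//; last exact: measurableI.
  have := @exchangeable_injective _ _ _ _ _ _ _ 2
    (fun l => if l == ord0 then i else j) (fun=> A) hX.
  have <- : [set w | forall l : 'I_2, A (X (if l == ord0 then i else j) w)] =
      B i `&` B j.
    apply/seteqP; split => w; last by move=> [Bi Bj] l; case: ifP.
    by move=> h; split; [exact: (h ord0)|exact: (h ord_max)].
  move=> ->//; last first.
    move=> x y; case: (eqVneq x ord0) => [->|x0];
      case: (eqVneq y ord0) => [->//|y0] => eij.
    - by move: ij; rewrite eij eqxx.
    - by move: ij; rewrite eij eqxx.
    - by apply/val_inj; case: x x0 {eij} => -[|[|x]]//; case: y y0 => -[|[|y]].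
  congr (P _); apply/seteqP; split => w.
    by move=> h; split; [exact: (h ord0)|exact: (h ord_max)].
  by move=> [B0 B1]; case=> -[|[|l]].
(* [a i] is the coefficient of the [i]-th indicator in
   [freq X A m - freq X A n]. *)
pose a i : R := (m%:R^-1 - (i < n)%:R * n%:R^-1)%R.
have trunc (f : nat -> R) :
    (\sum_(i < m) (i < n)%:R * f i = \sum_(i < n) f i)%R.
  rewrite (big_ord_widen m f nm) [RHS]big_mkcond/=.
  by apply: eq_bigr => i _; case: ifP; rewrite ?mul1r ?mul0r.
have nN0 : (n%:R != 0 :> R)%R by rewrite pnatr_eq0 -lt0n.
have mN0 : (m%:R != 0 :> R)%R by rewrite pnatr_eq0 -lt0n.
have suma : (\sum_(i < m) a i = 0)%R.
  rewrite sumrB (trunc (fun=> n%:R^-1)%R) !sumr_const !card_ord.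
  by rewrite -(mulr_natr m%:R^-1) -(mulr_natr n%:R^-1) !mulVf// subrr.
have suma2 : (\sum_(i < m) a i ^+ 2 = n%:R^-1 - m%:R^-1)%R.
  pose c : R := (n%:R^-1 ^+ 2 - 2 * (n%:R^-1 * m%:R^-1))%R.
  have E2 (i : 'I_m) : (a i ^+ 2 = m%:R^-1 ^+ 2 + (i < n)%:R * c)%R.
    by rewrite /a /c; case: (i < n)%N; rewrite ?mul1r ?mul0r; ring.
  rewrite (eq_bigr _ (fun i _ => E2 i)) big_split/= (trunc (fun=> c)).
  rewrite !sumr_const !card_ord.
  rewrite -(mulr_natr (m%:R^-1 ^+ 2)) -(mulr_natr c) /c.
  by field; rewrite nN0 mN0.
have E1 w : (freq A m w - freq A n w = \sum_(i < m) a i * \1_(B i) w)%R.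
  rewrite /freq -(trunc (fun i => \1_A (X i w))) !mulr_sumr -sumrB.
  apply: eq_bigr => i _; rewrite -[\1_(B i) w]/(\1_A (X i w)) /a mulrBl.
  by rewrite mulrCA mulrA.
under eq_integral do rewrite E1.
rewrite (second_moment_indic_sum mB PB PBB) suma suma2 lee_fin.
rewrite expr0n mulr0 add0r.
have q0 : (0 <= q)%R by rewrite fine_ge0.
have p1 : (p <= 1)%R.
  by rewrite -lee_fin -(PB 0%N); exact: probability_le1.
have mn1 : (0 <= n%:R^-1 - m%:R^-1 :> R)%R.
  by rewrite subr_ge0 lef_pV2 ?posrE ?ltr0n// ler_nat.
have m1 : (0 <= m%:R^-1 :> R)%R by rewrite invr_ge0.
apply: (@le_trans _ _ (1 * (n%:R^-1 - m%:R^-1)))%R; last lra.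
by apply: ler_wpM2r => //; lra.
Qed.

(** The product of the frequencies is the average, over all maps [f] from ['I_k]
    to ['I_n], of the indicators of [forall i, A i (X (f i))].  The injective
    [f] all give the target value, and the other ones are few. *)
Lemma freq_moment (k n : nat) (A : 'I_k -> set E) : (0 < n)%N ->
  (forall i, measurable (A i)) ->
  `|\int[P]_w (\prod_(i < k) freq (A i) n w)%:E -
    P [set w | forall i : 'I_k, A i (X i w)]| <= ((k ^ 2)%:R / n%:R)%:E.
Proof.
move=> n0 mA.
have nk0 : (0 < (n ^ k)%:R :> R)%R by rewrite ltr0n expn_gt0 n0.
pose S (f : {ffun 'I_k -> 'I_n}) := [set w | forall i, A i (X (f i) w)].
have mS f : measurable (S f).
  exact: (measurable_forall_rv X (fun i => val (f i)) mA).
have mS0 : measurable [set w | forall i : 'I_k, A i (X i w)].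
  exact: (measurable_forall_rv X (fun i : 'I_k => val i) mA).
pose r := fine (P [set w | forall i : 'I_k, A i (X i w)]).
have rE : P [set w | forall i : 'I_k, A i (X i w)] = r%:E.
  by rewrite /r fineK// fin_num_measure.
pose s f := fine (P (S f)).
have sE f : P (S f) = (s f)%:E by rewrite /s fineK// fin_num_measure.
have r01 : (0 <= r <= 1)%R.
  by rewrite -!lee_fin -rE measure_ge0 probability_le1.
have s01 f : (0 <= s f <= 1)%R.
  by rewrite -!lee_fin -sE measure_ge0 probability_le1.
have s_inj (f : {ffun 'I_k -> 'I_n}) : injectiveb f -> s f = r.
  move/injectiveP => finj; rewrite /s /r; congr fine.
  apply: (@exchangeable_injective _ _ _ _ _ _ X _ (fun i => val (f i))) => //.
  exact: inj_comp val_inj finj.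
have prodE w : (\prod_(i < k) freq (A i) n w)%:E =
    \sum_(f : {ffun 'I_k -> 'I_n}) ((n ^ k)%:R^-1)%:E * (\1_(S f) w)%:E.
  rewrite /freq big_split/= prodr_const card_ord bigA_distr_bigA/=.
  rewrite exprVn -natrX mulr_sumr -sumEFin; apply: eq_bigr => f _.
  rewrite EFinM; congr (_ * _%:E); rewrite indicE.
  have [/set_mem Sf|Sf] := boolP (w \in S f).
    by apply: big1 => i _; rewrite indicE mem_set//; exact: Sf.
  have [i Ai] : exists i, ~ A i (X (f i) w).
    by apply/existsNP => Sw; move/negP: Sf; apply; exact: mem_set.
  by rewrite (bigD1 i)//= indicE memNset// mul0r.
have -> : \int[P]_w (\prod_(i < k) freq (A i) n w)%:E =
    (\sum_(f : {ffun 'I_k -> 'I_n}) (n ^ k)%:R^-1 * s f)%:E.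
  under eq_integral do rewrite prodE.
  rewrite integral_sum//; last first.
    by move=> f; apply: integrableZl => //; exact: integrable_indic.
  rewrite -sumEFin; apply: eq_bigr => f _.
  rewrite integralZl//; last exact: integrable_indic.
  by rewrite integral_indic// setIT EFinM -sE.
rewrite rE -EFinB abse_EFin lee_fin.
have sum_inj : (\sum_(f : {ffun 'I_k -> 'I_n}) (injectiveb f)%:R =
    (n ^_ k)%:R :> R)%R.
  rewrite -[in RHS](card_ord n) -[in RHS](card_ord k) -card_inj_ffuns.
  rewrite -sum1_card natr_sum [RHS]big_mkcond/=.
  by apply: eq_bigr => f _; rewrite inE; case: (injectiveb f).
have sum_one : (\sum_(f : {ffun 'I_k -> 'I_n}) 1 = (n ^ k)%:R :> R)%R.
  by rewrite sumr_const card_ffun !card_ord.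
have -> : (\sum_(f : {ffun 'I_k -> 'I_n}) (n ^ k)%:R^-1 * s f - r =
    (n ^ k)%:R^-1 * \sum_(f : {ffun 'I_k -> 'I_n}) (s f - r))%R.
  rewrite -mulr_sumr sumrB mulrBr; congr (_ - _)%R.
  rewrite -[X in (\sum_f X)%R]mulr1 -mulr_sumr sum_one mulrCA mulVf ?mulr1//.
  by rewrite gt_eqF.
rewrite normrM gtr0_norm ?invr_gt0//.
apply: (@le_trans _ _ ((n ^ k)%:R^-1 *
    \sum_(f : {ffun 'I_k -> 'I_n}) (1 - (injectiveb f)%:R)))%R.
  rewrite ler_pM2l ?invr_gt0//; apply: (le_trans (ler_norm_sum _ _ _)).
  apply: ler_sum => f _; have [finj|_] := boolP (injectiveb f).
    by rewrite s_inj// subrr normr0 subrr.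
  by rewrite subr0 ler_norml; move: r01 (s01 f) => /andP[? ?] /andP[? ?]; lra.
rewrite sumrB sum_one sum_inj mulrBr mulVf ?gt_eqF// mulrC.
by rewrite lerBlDr -lerBlDl; exact: ffact_ratio_ge.
Qed.

End exchangeable.
End empirical_frequency.

(** * Limiting frequencies *)

Section limn_sup_unit.
Context (R : realType).
Implicit Types u v : R^nat.

Lemma bounded_unit_seq u : (forall n, 0 <= u n <= 1)%R ->
  has_ubound (range u) /\ has_lbound (range u).
Proof.
by move=> u01; split; [exists 1%R|exists 0%R] => _ [n _ <-];
  have /andP[] := u01 n.
Qed.

Lemma le_limn_sup u v : (forall n, 0 <= u n)%R ->
  (forall n, u n <= v n)%R -> (forall n, v n <= 1)%R ->
  (limn_sup u <= limn_sup v)%R.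
Proof.
move=> u0 uv v1.
have [uu lu] : has_ubound (range u) /\ has_lbound (range u).
  by apply: bounded_unit_seq => n; rewrite u0 (le_trans (uv n)).
have [uw lv] : has_ubound (range v) /\ has_lbound (range v).
  by apply: bounded_unit_seq => n; rewrite v1 (le_trans (u0 n)).
apply: ler_lim.
- by apply: cvgP; exact: cvg_sups_inf.
- by apply: cvgP; exact: cvg_sups_inf.
- apply: nearW => n; apply: ge_sup.
    by exists (u n); exists n => /=.
  move=> _ [m /= nm <-]; apply: (le_trans (uv m)).
  by apply: ub_le_sup; [exact: has_ubound_sdrop|exists m].
Qed.

End limn_sup_unit.

Section limiting_frequency.
Context (R : realType) (d d' : measure_display) (Omega : measurableType d)
  (P : probability Omega R) (E : measurableType d').
Variable X : nat -> {RV P >-> E}.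

(** The superior limit makes the value defined, monotone in [A] and between 0
    and 1 for every outcome; it is a limit only almost surely. *)
Definition limfreq (A : set E) (w : Omega) : R :=
  limn_sup (fun m => freq X A (4 ^ m) w).

Lemma le_limfreq A B w : A `<=` B -> (limfreq A w <= limfreq B w)%R.
Proof.
move=> AB; apply: le_limn_sup => m; [exact: freq_ge0|exact: le_freq|].
exact: freq_le1.
Qed.

Lemma limfreq_cvg A w l : freq X A (4 ^ m) w @[m --> \oo] --> l ->
  limfreq A w = l.
Proof. by move=> /cvg_limn_inf_sup[]. Qed.

Lemma limfreqT w : limfreq [set: E] w = 1%R.
Proof.
apply: limfreq_cvg; under eq_fun do rewrite freqT ?expn_gt0//.
exact: cvg_cst.
Qed.

Lemma limfreq0 w : limfreq set0 w = 0%R.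
Proof.
apply: limfreq_cvg; rewrite (_ : (fun _ => _) = cst 0%R); first exact: cvg_cst.
by apply/funext => m; rewrite -setCT freqC ?expn_gt0// freqT ?expn_gt0// subrr.
Qed.

Lemma limfreq_ge0 A w : (0 <= limfreq A w)%R.
Proof. by rewrite -(limfreq0 w); exact: le_limfreq. Qed.

Lemma limfreq_le1 A w : (limfreq A w <= 1)%R.
Proof. by rewrite -(limfreqT w); exact: le_limfreq. Qed.

Lemma measurable_limfreq A : measurable A ->
  measurable_fun [set: Omega] (limfreq A).
Proof.
move=> mA; apply: measurable_fun_limn_sup => [w _|w _|m].
- by have [] := @bounded_unit_seq R (fun m => freq X A (4 ^ m) w)
    (fun m => introT andP (conj (freq_ge0 _ _ _ _) (freq_le1 _ _ _ _))).
- by have [] := @bounded_unit_seq R (fun m => freq X A (4 ^ m) w)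
    (fun m => introT andP (conj (freq_ge0 _ _ _ _) (freq_le1 _ _ _ _))).
- exact: measurable_freq.
Qed.

Hypothesis hX : exchangeable X.

Lemma ae_cvg_limfreq A : measurable A ->
  {ae P, forall w, freq X A (4 ^ m) w @[m --> \oo] --> limfreq A w}.
Proof.
move=> mA.
have : {ae P, forall w, cvgn (fun m => freq X A (4 ^ m) w)}.
  apply: (@ae_cvgn_of_L2_increments _ _ _ _ (fun m => freq X A (4 ^ m))).
    by move=> m; exact: measurable_freq.
  move=> m; rewrite -natrX; apply: freq_L2_increment => //.
  by rewrite expn_gt0/= leq_exp2l.
by apply: filterS => w cw; rewrite /limfreq cvg_limn_supE.
Qed.

(** De Finetti's identity for the limiting frequencies: dominated convergence in
    [freq_moment]. *)
Lemma exchangeable_limfreq (k : nat) (A : 'I_k -> set E) :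
  (forall i, measurable (A i)) ->
  P [set w | forall i : 'I_k, A i (X i w)] =
  \int[P]_w (\prod_(i < k) limfreq (A i) w)%:E.
Proof.
move=> mA.
have lim1 : \int[P]_w (\prod_(i < k) freq X (A i) (4 ^ m) w)%:E
    @[m --> \oo] --> \int[P]_w (\prod_(i < k) limfreq (A i) w)%:E.
  have mfr m : measurable_fun [set: Omega]
      (fun w => (\prod_(i < k) freq X (A i) (4 ^ m) w)%:E).
    apply/measurable_EFinP.
    by apply: measurable_prod => i _; exact: measurable_freq.
  have mlf : measurable_fun [set: Omega]
      (fun w => (\prod_(i < k) limfreq (A i) w)%:E).
    apply/measurable_EFinP.
    by apply: measurable_prod => i _; exact: measurable_limfreq.
  have cvg_ae : {ae P, forall w, [set: Omega] w ->
      (\prod_(i < k) freq X (A i) (4 ^ m) w)%:E @[m --> \oo] -->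
      (\prod_(i < k) limfreq (A i) w)%:E}.
    have : {ae P, forall w, forall i : 'I_k,
        freq X (A i) (4 ^ m) w @[m --> \oo] --> limfreq (A i) w}.
      by apply: filter_forall => i; exact: ae_cvg_limfreq.
    apply: filterS => w cw _; apply: cvg_EFin; first exact: nearW.
    by apply: cvg_big => //; exact: mul_continuous.
  have dom : {ae P, forall w m, [set: Omega] w ->
      `|(\prod_(i < k) freq X (A i) (4 ^ m) w)%:E| <= cst 1 w}.
    apply: aeW => w m _; rewrite lee_fin ger0_norm ?prodr_ge0// => [|i _].
      by apply: prodr_ile1 => i _; rewrite freq_ge0 freq_le1.
    exact: freq_ge0.
  have int1 : P.-integrable [set: Omega] (cst 1).
    exact: finite_measure_integrable_cst.
  by have [] := @dominated_convergence _ _ _ P _ measurableT _ _ _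
    mfr mlf cvg_ae int1 dom.
have lim2 : \int[P]_w (\prod_(i < k) freq X (A i) (4 ^ m) w)%:E
    @[m --> \oo] --> P [set w | forall i : 'I_k, A i (X i w)].
  have mS0 : measurable [set w | forall i : 'I_k, A i (X i w)].
    exact: (measurable_forall_rv X (fun i : 'I_k => val i) mA).
  apply/sube_cvg0; first by rewrite fin_num_measure.
  apply/cvg_abse0P.
  apply: (@squeeze_cvge _ _ _ _ (cst 0) _
    (fun m => (geometric (k ^ 2)%:R 4^-1 m)%:E)).
  - apply: nearW => m; rewrite abse_ge0/=.
    rewrite (le_trans (freq_moment hX _ mA)) ?expn_gt0//.
    by rewrite /geometric/= exprVn (natrX _ 4 m).
  - exact: cvg_cst.
  - apply: cvg_EFin; first exact: nearW.
    by apply: cvg_geometric; rewrite ger0_norm// invf_lt1// ltr1n.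
exact: cvg_unique lim2 lim1.
Qed.

Lemma integral_limfreq A : measurable A ->
  \int[P]_w (limfreq A w)%:E = P (X 0%N @^-1` A).
Proof.
move=> mA; have := @exchangeable_limfreq 1 (fun=> A) (fun=> mA).
under eq_integral do rewrite big_ord1.
move=> <-; congr (P _); apply/seteqP; split => w /=.
  by move/(_ ord0).
by move=> Xw i; rewrite ord1.
Qed.

End limiting_frequency.

(** * Almost sure countable additivity of the limiting frequencies *)

Lemma integrable_bounded (R : realType) (d : measure_display)
    (Omega : measurableType d) (P : probability Omega R) (f : Omega -> R)
    (M : R) :
  measurable_fun [set: Omega] f -> (forall w, `|f w| <= M)%R ->
  P.-integrable [set: Omega] (EFin \o f).
Proof.
move=> mf fM; apply: measurable_bounded_integrable => //.
  by rewrite fin_num_fun_lty//; exact: fin_num_measure.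
exists M; split; first exact: num_real.
by move=> y My w _; exact: le_trans (fM w) (ltW My).
Qed.

Lemma ae_eq_of_le_integral (R : realType) (d : measure_display)
    (Omega : measurableType d) (P : probability Omega R)
    (f : Omega -> \bar R) (g : Omega -> R) :
  measurable_fun [set: Omega] f -> measurable_fun [set: Omega] g ->
  (forall w, 0 <= f w) -> (forall w, 0 <= g w <= 1)%R ->
  {ae P, forall w, f w <= (g w)%:E} ->
  \int[P]_w (g w)%:E = \int[P]_w f w ->
  {ae P, forall w, f w = (g w)%:E}.
Proof.
move=> mf mg f0 g01 fg gf.
have ig : P.-integrable [set: Omega] (EFin \o g).
  apply: (@integrable_bounded _ _ _ _ _ 1%R) => // w.
  by rewrite ger0_norm; case/andP: (g01 w).
have if_ : P.-integrable [set: Omega] f.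
  apply/integrableP; split => //.
  under eq_integral do rewrite gee0_abs//.
  by rewrite -gf; exact: integrable_lty ig.
have mh : measurable_fun [set: Omega] (fun w => (g w)%:E - f w).
  by apply: emeasurable_funB => //; exact/measurable_EFinP.
have : \int[P]_w `|(g w)%:E - f w| = 0.
  transitivity (\int[P]_w ((g w)%:E - f w)).
    apply: ae_eq_integral => //; first exact: measurableT_comp.
    apply: filterS fg => w fgw _.
    by rewrite gee0_abs ?subre_ge0.
  rewrite integralB// gf subee//.
  exact: integrable_fin_num.
move/(ae_eq_integral_abs _ measurableT mh).1; apply: filterS2 fg => w fgw.
move=> /(_ I) /= /eqP; rewrite sube_eq ?add0e//; first by move=> /eqP.
Qed.

Section limiting_frequency_additive.
Context (R : realType) (d d' : measure_display) (Omega : measurableType d)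
  (P : probability Omega R) (E : measurableType d').
Variable X : nat -> {RV P >-> E}.
Hypothesis hX : exchangeable X.

Lemma ae_limfreqC A : measurable A ->
  {ae P, forall w, limfreq X (~` A) w = (1 - limfreq X A w)%R}.
Proof.
move=> mA; apply: filterS (ae_cvg_limfreq hX mA) => w cw.
apply: limfreq_cvg; under eq_fun do rewrite freqC ?expn_gt0//.
by apply: cvgB => //; exact: cvg_cst.
Qed.

(** Superadditivity passes to the limit from the empirical frequencies; equality
    follows because both sides have expectation [P (X 0 \in \bigcup_j F j)]. *)
Lemma ae_limfreq_bigcup (F : (set E)^nat) : (forall j, measurable (F j)) ->
  trivIset [set: nat] F ->
  {ae P, forall w, \sum_(0 <= j <oo) (limfreq X (F j) w)%:E =
    (limfreq X (\bigcup_j F j) w)%:E}.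
Proof.
move=> mF tF; have mU : measurable (\bigcup_j F j) by exact: bigcup_measurable.
have mlf j : measurable_fun [set: Omega] (fun w => (limfreq X (F j) w)%:E).
  by apply/measurable_EFinP; exact: measurable_limfreq.
have lf0 j w : 0 <= (limfreq X (F j) w)%:E by rewrite lee_fin limfreq_ge0.
apply: ae_eq_of_le_integral.
- by apply: ge0_emeasurable_sum => [j w _ _|j _]; [exact: lf0|exact: mlf].
- exact: measurable_limfreq.
- by move=> w; apply: nneseries_ge0 => j _ _; exact: lf0.
- by move=> w; rewrite limfreq_ge0 limfreq_le1.
- have cF : {ae P, forall w, forall j,
      freq X (F j) (4 ^ m) w @[m --> \oo] --> limfreq X (F j) w}.
    by apply: ae_foralln => j; exact: ae_cvg_limfreq.
  apply: filterS2 cF (ae_cvg_limfreq hX mU) => w cF cU.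
  apply: lime_le; first by apply: is_cvg_nneseries => j _ _; exact: lf0.
  apply: nearW => N; rewrite sumEFin lee_fin big_mkord.
  have sumF : (\sum_(j < N) freq X (F j) (4 ^ m) w)%R @[m --> \oo] -->
      (\sum_(j < N) limfreq X (F j) w)%R.
    by apply: cvg_big => //; exact: add_continuous.
  apply: (ler_cvg_to sumF cU); apply: nearW => m; exact: sum_freq_le.
- rewrite integral_nneseries//.
  rewrite integral_limfreq// preimage_bigcup measure_bigcup//=.
  + rewrite (eq_eseriesl (Q := xpredT)) => [|j]; last by rewrite in_setT.
    by apply: eq_eseriesr => j _; rewrite integral_limfreq.
  + by move=> j _; rewrite -[X in measurable X]setTI; exact: measurable_funP.
  + by move=> i j _ _ [w [Fi Fj]]; apply: tF => //; exists (X 0%N w).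
Qed.

End limiting_frequency_additive.

(** * The right-continuous envelope of a nondecreasing function *)

Lemma probability_of_cdf (R : realType) (f : R -> R) :
  nondecreasing f -> right_continuous f ->
  f x @[x --> -oo%R] --> (0 : R)%R -> f x @[x --> +oo%R] --> (1 : R)%R ->
  exists mu : probability (measurableTypeR R) R,
    forall x, mu `]-oo, x]%classic = (f x)%:E.
Proof.
move=> nd rc fNy fy.
pose c1 := isCumulative.Build R _ R f nd rc.
pose c2 := isCumulativeBounded.Build R 0%R 1%R f fNy fy.
pose F : cumulativeBounded (0 : R)%R (1 : R)%R := HB.pack f c1 c2.
exists (lebesgue_stieltjes_measure F) => x.
exact: (cdf_lebesgue_stieltjes_id F x).
Qed.

Section right_envelope.
Context (R : realType).
Variable g : R -> R.
Hypotheses (g_nd : nondecreasing g) (g01 : forall x, (0 <= g x <= 1)%R).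

Definition right_envelope (x : R) : R := inf (g @` `]x, +oo[%classic).

Let has_inf_right x : has_inf (g @` `]x, +oo[%classic).
Proof.
split.
  by exists (g (x + 1)), (x + 1)%R => //=; rewrite in_itv/= andbT ltrDl.
by exists 0%R => _ [y _ <-]; case/andP: (g01 y).
Qed.

Lemma le_right_envelope x : (g x <= right_envelope x)%R.
Proof.
apply: lb_le_inf; first by have [] := has_inf_right x.
by move=> _ [y + <-]; rewrite /= in_itv/= andbT => /ltW; exact: g_nd.
Qed.

Lemma right_envelope_le x y : (x < y)%R -> (right_envelope x <= g y)%R.
Proof.
move=> xy; apply: ge_inf; first by have [] := has_inf_right x.
by exists y => //=; rewrite in_itv/= andbT.
Qed.

Lemma nondecreasing_right_envelope : nondecreasing right_envelope.
Proof.
move=> x y; rewrite le_eqVlt => /predU1P[->//|xy].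
exact: le_trans (right_envelope_le xy) (le_right_envelope y).
Qed.

Lemma cvg_right_envelope x : g y @[y --> x^'+] --> right_envelope x.
Proof.
apply: nondecreasing_at_right_cvgr => //.
- by move=> y z _ _; exact: g_nd.
- by have [] := has_inf_right x.
Qed.

Lemma right_envelope_bounded x : (0 <= right_envelope x <= 1)%R.
Proof.
have /andP[g0 _] := g01 x; rewrite (le_trans g0 (le_right_envelope x))/=.
have /andP[_ g1] := g01 (x + 1)%R.
by apply: le_trans g1; apply: right_envelope_le; rewrite ltrDl.
Qed.

Lemma right_continuous_right_envelope : right_continuous right_envelope.
Proof.
move=> x; set S := right_envelope @` `]x, +oo[%classic.
have lbS : has_lbound S.
  by exists 0%R => _ [y _ <-]; case/andP: (right_envelope_bounded y).
have -> : right_envelope x = inf S.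
  apply/eqP; rewrite eq_le; apply/andP; split.
    apply: lb_le_inf.
      exists (right_envelope (x + 1)), (x + 1)%R => //=.
      by rewrite in_itv/= andbT ltrDl.
    move=> _ [y + <-]; rewrite /= in_itv/= andbT => /ltW.
    exact: nondecreasing_right_envelope.
  apply: lb_le_inf; first by have [] := has_inf_right x.
  move=> _ [y + <-]; rewrite /= in_itv/= andbT => xy.
  apply: (@le_trans _ _ (right_envelope ((x + y) / 2))%R).
    by apply: ge_inf => //; exists ((x + y) / 2)%R => //=;
      rewrite in_itv/= andbT midf_lt.
  by apply: right_envelope_le; rewrite midf_lt.
apply: nondecreasing_at_right_cvgr => //.
by move=> y z _ _; exact: nondecreasing_right_envelope.
Qed.

Hypotheses (g_eq0 : forall x, (x <= 0)%R -> g x = 0%R)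
  (g_eq1 : forall x, (1 <= x)%R -> g x = 1%R).

Lemma right_envelope_Ny : right_envelope x @[x --> -oo%R] --> (0 : R)%R.
Proof.
apply: cvg_near_cst; near=> x.
have x0 : (x < 0)%R by near: x; exact: nbhs_ninfty_lt.
apply/eqP; rewrite eq_le; have /andP[-> _] := right_envelope_bounded x.
by rewrite andbT -(g_eq0 (lexx 0%R)) right_envelope_le.
Unshelve. all: end_near. Qed.

Lemma right_envelope_y : right_envelope x @[x --> +oo%R] --> (1 : R)%R.
Proof.
apply: cvg_near_cst; near=> x.
have x1 : (1 <= x)%R by near: x; exact: nbhs_pinfty_ge.
apply/eqP; rewrite eq_le; have /andP[_ ->] := right_envelope_bounded x.
by rewrite -(g_eq1 x1) le_right_envelope.
Unshelve. all: end_near. Qed.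

Lemma probability_of_right_envelope :
  exists mu : probability (measurableTypeR R) R,
    forall x, mu `]-oo, x]%classic = (right_envelope x)%:E.
Proof.
apply: probability_of_cdf.
- exact: nondecreasing_right_envelope.
- exact: right_continuous_right_envelope.
- exact: right_envelope_Ny.
- exact: right_envelope_y.
Qed.

End right_envelope.

(** * The directing random measure *)

(** The map [t |-> expR (- expR t)] embeds the real line into the open unit
    interval; a bounded range makes the tails of the limiting distribution
    function trivial for every outcome. *)
Lemma borel_space_embedding (R : realType) (d : measure_display)
    (E : measurableType d) : borel_space R E ->
  exists (psi : E -> R) (phi : R -> E),
    [/\ measurable_fun [set: E] psi, measurable_fun [set: R] phi,
        cancel psi phi & forall x, (0 < psi x < 1)%R].
Proof.
move=> [B [f [g [mB [fB _ _] fK mf mg]]]].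
pose h y := if y \in B then g y else point.
have mh : measurable_fun [set: R] h.
  apply: measurable_fun_if => //.
  - by apply: (measurable_fun_bool true); rewrite setTI preimage_mem_true.
  - by rewrite setTI preimage_mem_true.
exists (fun x => expR (- expR (f x))), (fun y => h (ln (- ln y))); split.
- apply: measurableT_comp => //; apply: measurableT_comp => //.
  exact: measurableT_comp.
- apply: measurableT_comp => //; apply: measurableT_comp => //.
  exact: measurableT_comp.
- move=> x; rewrite expRK opprK expRK /h mem_set ?fK//.
  exact: fB.
- by move=> x; rewrite expR_gt0 expR_lt1 oppr_lt0 expR_gt0.
Qed.

Section directing_measure.
Context (R : realType) (d d' : measure_display) (Omega : measurableType d)
  (P : probability Omega R) (E : measurableType d').
Variable X : nat -> {RV P >-> E}.
Hypothesis hX : exchangeable X.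
Variable psi : E -> R.
Hypotheses (mpsi : measurable_fun [set: E] psi)
  (psi01 : forall x, (0 < psi x < 1)%R).

Let G (U : set R) (w : Omega) : R := limfreq X (psi @^-1` U) w.

Let mpre (U : set R) : measurable U -> measurable (psi @^-1` U).
Proof. by move=> mU; rewrite -[X in measurable X]setTI; exact: mpsi. Qed.

Definition limit_cdf (w : Omega) (x : R) : R := G `]-oo, x]%classic w.

Lemma nondecreasing_limit_cdf w : nondecreasing (limit_cdf w).
Proof.
move=> x y xy; apply: le_limfreq => e /=; rewrite !in_itv/= => /le_trans.
exact.
Qed.

Lemma limit_cdf_bounded w x : (0 <= limit_cdf w x <= 1)%R.
Proof. by rewrite limfreq_ge0 limfreq_le1. Qed.

Lemma limit_cdf_eq0 w x : (x <= 0)%R -> limit_cdf w x = 0%R.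
Proof.
move=> x0; rewrite /limit_cdf /G (_ : _ @^-1` _ = set0) ?limfreq0//.
apply/seteqP; split => // e /=; rewrite in_itv/= => ex.
by have /andP[] := psi01 e; rewrite ltNge (le_trans ex x0).
Qed.

Lemma limit_cdf_eq1 w x : (1 <= x)%R -> limit_cdf w x = 1%R.
Proof.
move=> x1; rewrite /limit_cdf /G (_ : _ @^-1` _ = setT) ?limfreqT//.
apply/seteqP; split => // e _ /=; rewrite in_itv/=.
by have /andP[_ /ltW e1] := psi01 e; exact: le_trans x1.
Qed.

Let F w := right_envelope (limit_cdf w).

Let shift_gt (x : R) (n : nat) : (x < x + n.+1%:R^-1)%R.
Proof. by rewrite ltrDl invr_gt0. Qed.

Let cvg_shift (x : R) : (x + n.+1%:R^-1)%R @[n --> \oo] --> x.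
Proof.
rewrite -[X in _ --> X]addr0; apply: cvgD; first exact: cvg_cst.
exact: cvg_harmonic.
Qed.

Lemma cvg_limit_cdf_right w x :
  limit_cdf w (x + n.+1%:R^-1)%R @[n --> \oo] --> F w x.
Proof.
have /cvg_at_rightP := @cvg_right_envelope _ _ (@nondecreasing_limit_cdf w)
  (limit_cdf_bounded w) x.
by apply; split => [n|]; [exact: shift_gt|exact: cvg_shift].
Qed.

Lemma measurable_right_limit_cdf x : measurable_fun [set: Omega] (F ^~ x).
Proof.
apply: (measurable_fun_cvg (h := fun n w => limit_cdf w (x + n.+1%:R^-1)%R)).
  by move=> n; apply: measurable_limfreq; exact: mpre.
by move=> w _; exact: cvg_limit_cdf_right.
Qed.

(** The envelope dominates the function, and both have expectation
    [P (psi (X 0) <= x)], by continuity from above of [P] for the envelope. *)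
Lemma ae_right_limit_cdf x :
  {ae P, forall w, limit_cdf w x = F w x}.
Proof.
have mGx y : measurable_fun [set: Omega] (fun w => limit_cdf w y).
  by apply: measurable_limfreq; exact: mpre.
have F01 w y : (0 <= F w y <= 1)%R.
  apply: right_envelope_bounded; first exact: nondecreasing_limit_cdf.
  exact: limit_cdf_bounded.
suff : {ae P, forall w, (limit_cdf w x)%:E = (F w x)%:E}.
  by apply: filterS => w [].
apply: ae_eq_of_le_integral.
- by apply/measurable_EFinP.
- exact: measurable_right_limit_cdf.
- by move=> w; rewrite lee_fin limfreq_ge0.
- by move=> w; exact: F01.
- apply: aeW => w; rewrite lee_fin; apply: le_right_envelope.
    exact: nondecreasing_limit_cdf.
  exact: limit_cdf_bounded.
have -> : \int[P]_w (limit_cdf w x)%:E =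
    P (X 0%N @^-1` (psi @^-1` `]-oo, x]%classic)).
  by apply: integral_limfreq => //; exact: mpre.
apply/eqP; rewrite eq_le; apply/andP; split; last first.
  rewrite -integral_limfreq//; last exact: mpre.
  apply: ge0_le_integral => //.
  - by move=> w _; rewrite lee_fin limfreq_ge0.
  - by apply/measurable_EFinP; exact: mGx.
  - by apply/measurable_EFinP; exact: measurable_right_limit_cdf.
  - move=> w _; rewrite lee_fin; apply: le_right_envelope.
      exact: nondecreasing_limit_cdf.
    exact: limit_cdf_bounded.
pose S n := X 0%N @^-1` (psi @^-1` `]-oo, (x + n.+1%:R^-1)%R]%classic).
have mS n : measurable (S n).
  rewrite /S -[X in measurable X]setTI; apply: measurable_funP => //.
  exact: mpre.
have PS : P (S n) @[n --> \oo] --> P (\bigcap_n S n).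
  apply: nonincreasing_cvg_mu => //.
  - by rewrite -ge0_fin_numE// fin_num_measure.
  - exact: bigcapT_measurable.
  - move=> m n mn; apply/subsetPset => w; rewrite /S/= !in_itv/= => /le_trans.
    by apply; rewrite lerD2l lef_pV2 ?posrE// ler_nat.
have SE : \bigcap_n S n = X 0%N @^-1` (psi @^-1` `]-oo, x]%classic).
  by rewrite (itvNycEbigcap false) !preimage_bigcap.
rewrite -SE -(cvg_lim _ PS)//; apply: lime_ge; first exact: cvgP PS.
apply: nearW => n; rewrite -integral_limfreq//; last exact: mpre.
apply: ge0_le_integral => //.
- by move=> w _; rewrite lee_fin; case/andP: (F01 w x).
- by apply/measurable_EFinP; exact: measurable_right_limit_cdf.
- by apply/measurable_EFinP; exact: mGx.
- move=> w _; rewrite lee_fin; apply: right_envelope_le.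
  + exact: limit_cdf_bounded.
  + exact: shift_gt.
Qed.

(** The Borel sets on which the random Lebesgue-Stieltjes measure is measurable
    and almost surely equal to the limiting frequency contain the half-lines and
    form a Dynkin system. *)
Lemma directing_measure_real :
  exists mu : Omega -> probability (measurableTypeR R) R,
    forall U : set R, measurable U ->
      measurable_fun [set: Omega] (fun w => mu w U) /\
      {ae P, forall w, mu w U = (limfreq X (psi @^-1` U) w)%:E}.
Proof.
have /choice[mu muF] w : exists mu : probability (measurableTypeR R) R,
    forall x, mu `]-oo, x]%classic = (F w x)%:E.
  apply: probability_of_right_envelope.
  - exact: nondecreasing_limit_cdf.
  - exact: limit_cdf_bounded.
  - by move=> x; exact: limit_cdf_eq0.
  - by move=> x; exact: limit_cdf_eq1.
exists mu.
pose good (U : set R) := measurable_fun [set: Omega] (fun w => mu w U) /\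
  {ae P, forall w, mu w U = (G U w)%:E}.
have goodC (U : set R) : measurable U -> good U -> good (~` U).
  move=> mU [mmu aemu].
  have muC w : mu w (~` U) = 1 - mu w U by exact: probability_setC.
  split.
    by under eq_fun do rewrite muC; exact: emeasurable_funB.
  apply: filterS2 aemu (ae_limfreqC hX (mpre mU)) => w muU GC.
  by rewrite muC muU /G preimage_setC GC EFinB.
have goodU (S : (set R)^nat) : (forall n, measurable (S n)) ->
    trivIset [set: nat] S -> (forall n, good (S n)) -> good (\bigcup_k S k).
  move=> mS tS gS.
  have muU w : mu w (\bigcup_k S k) = \sum_(0 <= k <oo) mu w (S k).
    rewrite measure_bigcup; [|by move=> k _; exact: mS|by []].
    by apply: eq_eseriesl => k; rewrite in_setT.
  split.
    under eq_fun do rewrite muU.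
    by apply: ge0_emeasurable_sum => // k _; have [] := gS k.
  have ae_all : {ae P, forall w, forall k, mu w (S k) = (G (S k) w)%:E}.
    by apply: ae_foralln => k; have [] := gS k.
  have tpre : trivIset [set: nat] (fun k => psi @^-1` (S k)).
    by move=> i j _ _ [e [Si Sj]]; apply: tS => //; exists (psi e).
  apply: filterS2 ae_all (ae_limfreq_bigcup hX (fun k => mpre (mS k)) tpre).
  move=> w muS GU; rewrite muU /G preimage_bigcup -GU.
  by apply: eq_eseriesr => k _; exact: muS.
have good_ray x : good `]-oo, x]%classic.
  split.
    under eq_fun do rewrite muF.
    by apply/measurable_EFinP; exact: measurable_right_limit_cdf.
  by apply: filterS (ae_right_limit_cdf x) => w; rewrite muF /limit_cdf => ->.
have genE : (measurable : set (set R)) = <<s @RGenOInfty.G R >>.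
  exact: RGenOInfty.measurableE.
move=> U mU; have {mU} : <<s @RGenOInfty.G R >> U by rewrite -genE.
move: U; apply: (dynkin_induction genE).
- move=> _ _ [x ->] [y ->]; exists (Order.max x y).
  by apply/seteqP; split => z /=; rewrite !in_itv/= !andbT gt_max => /andP.
- have muT w : mu w [set: R] = 1 by exact: probability_setT.
  split; first by under eq_fun do rewrite muT; exact: measurable_cst.
  by apply: aeW => w; rewrite muT /G preimage_setT limfreqT.
(* The generators are open half-lines ]x, +oo[, complements of the sets
   ]-oo, x] covered by the envelope. *)
- by move=> _ [x ->]; rewrite -setCitvl; exact: goodC.
- exact: goodC.
- exact: goodU.
Qed.

End directing_measure.

Lemma emeasurable_prod (R : realType) (d : measure_display)
    (T : measurableType d) (D : set T) (I : Type) (s : seq I)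
    (f : I -> T -> \bar R) :
  (forall i, measurable_fun D (f i)) ->
  measurable_fun D (fun x => \prod_(i <- s) f i x).
Proof.
move=> mf; elim: s => [|i s IH].
  by under eq_fun do rewrite big_nil; exact: measurable_cst.
by under eq_fun do rewrite big_cons; exact: emeasurable_funM.
Qed.

Theorem theorem1 (R : realType) (d d' : measure_display)
    (Omega : measurableType d) (P : probability Omega R)
    (E : measurableType d') (hE : borel_space R E)
    (X : nat -> {RV P >-> E}) (hX : exchangeable X) :
  exists M : {RV P >-> pprobability E R},
    forall k : nat, (0 < k)%N ->
    forall A : 'I_k -> set E, (forall i, measurable (A i)) ->
      P [set w | forall i : 'I_k, A i (X i w)] =
      \int[distribution P M]_mu \prod_(i < k) (mu : probability E R) (A i).
Proof.
have [psi [phi [mpsi mphi psiK psi01]]] := borel_space_embedding hE.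
have [mu muE] := directing_measure_real hX mpsi psi01.
have mpre A : measurable A -> measurable (phi @^-1` A).
  by move=> mA; rewrite -[X in measurable X]setTI; exact: mphi.
pose phi_mixin := isMeasurableFun.Build _ _ (measurableTypeR R) E phi mphi.
pose Phi : {mfun measurableTypeR R >-> E} := HB.pack phi phi_mixin.
pose M0 (w : Omega) : pprobability E R := distribution (mu w) Phi.
have mM0 : measurable_fun [set: Omega] M0.
  apply: (measurability (@pset _ E R : set (set (pprobability E R)))) => //.
  move=> _ [_ [r _ [A mA <-]] <-].
  have [+ _] := muE _ (mpre _ mA).
  move=> /(_ measurableT `]-oo, r%:E[%classic (emeasurable_itv _)).
  by rewrite !setTI.
pose M_mixin := isMeasurableFun.Build _ _ Omega (pprobability E R) M0 mM0.
pose M : {mfun Omega >-> pprobability E R} := HB.pack M0 M_mixin.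
exists (M : {RV P >-> pprobability E R}) => k _ A mA.
(* Off the range of [psi], [phi] is arbitrary; only the identity
   [psi @^-1` (phi @^-1` A) = A] matters. *)
have M_limfreq : {ae P, forall w, forall i : 'I_k,
    M0 w (A i) = (limfreq X (A i) w)%:E}.
  apply: filter_forall => i; have [_] := muE _ (mpre _ (mA i)).
  apply: filterS => w muw; apply: (etrans muw).
  by congr (limfreq X _ w)%:E; apply/seteqP; split => e /=; rewrite psiK.
have mev i : measurable_fun [set: pprobability E R]
    (fun nu : pprobability E R => (nu : probability E R) (A i)).
  exact: (measurable_kernel (kprobability
    (@measurable_id _ (pprobability E R) setT))).
have mprod : measurable_fun [set: pprobability E R]
    (fun nu : pprobability E R => \prod_(i < k) (nu : probability E R) (A i)).
  exact: emeasurable_prod.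
rewrite ge0_integral_distribution//; last first.
  by move=> nu; apply: prode_ge0 => i _.
rewrite (exchangeable_limfreq hX mA); apply: ae_eq_integral => //.
- apply/measurable_EFinP.
  by apply: measurable_prod => i _; exact: measurable_limfreq.
- exact: measurableT_comp.
- apply: filterS M_limfreq => w Mw _ /=.
  rewrite -prodEFin; apply: eq_bigr => i _.
  by rewrite -Mw.
Qed.
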